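(* Let $A$ be a real $2\times2$ matrix with $(\operatorname{tr}A)^2-4\det A<0$ and $\operatorname{tr}A\neq 0$, let $\lambda\pm i\mu$ with $\mu>0$ be its eigenvalues, let $\eta\in\mathbb{R}^2\setminus\{0\}$, and let $\Omega=[u^-,u^+]$ with $u^-<u^+$. Put $$P^+:=\left(\frac{-u^++e^{\pi\lambda/\mu}u^-}{1-e^{\pi\lambda/\mu}}\right)A^{-1}\eta,\qquad P^-:=\left(\frac{-u^-+e^{\pi\lambda/\mu}u^+}{1-e^{\pi\lambda/\mu}}\right)A^{-1}\eta.$$ Then the subset of $\mathbb{R}^2$ $$\mathcal{O}:=\left\{\varphi(s,P^+,u^-) : s\in\left[0,\tfrac{\pi}{\mu}\right]\right\}\cup\left\{\varphi(s,P^-,u^+) : s\in\left[0,\tfrac{\pi}{\mu}\right]\right\}$$ is a periodic orbit of the linear control system $\dot v=Av+u\eta$, $u\in\Omega$.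
   Context: Control functions: $\mathcal{U}$ is the set of all piecewise constant functions $\mathbf{u}:\mathbb{R}\to\Omega$ (finitely many discontinuities on each bounded interval). For $v\in\mathbb{R}^2$ and $\mathbf{u}\in\mathcal{U}$, $s\in\mathbb{R}\mapsto\varphi(s,v,\mathbf{u})$ is the unique continuous, piecewise differentiable curve with $\varphi(0,v,\mathbf{u})=v$ and $\frac{d}{ds}\varphi(s,v,\mathbf{u})=A\varphi(s,v,\mathbf{u})+\mathbf{u}(s)\eta$ (away from the discontinuities of $\mathbf{u}$). For $u\in\Omega$, $\varphi(s,v,u)$ denotes the solution for the constant control $u$; explicitly, $\varphi(s,v,u)=e^{sA}(v-v(u))+v(u)$ with $v(u)=-uA^{-1}\eta$. A periodic orbit of the system is a set of the form $\{\varphi(s,v,\mathbf{u}) : s\in\mathbb{R}\}$ for some $v\in\mathbb{R}^2$ and $\mathbf{u}\in\mathcal{U}$ such that there is $T>0$ with $\varphi(s+T,v,\mathbf{u})=\varphi(s,v,\mathbf{u})$ for all $s\in\mathbb{R}$. *)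

(* Defs.v *)
From HB Require Import structures.
From mathcomp Require Import all_boot all_order all_algebra.
From mathcomp Require Import complex.
From mathcomp Require Import all_classical all_reals all_analysis.

Set Implicit Arguments.
Unset Strict Implicit.
Unset Printing Implicit Defensive.

Import Order.TTheory GRing.Theory Num.Theory.
Import numFieldNormedType.Exports.

Local Open Scope classical_set_scope.
Local Open Scope ring_scope.

Section LinearControlSystem.
Variable R : realType.

Definition discontinuities (u : R -> R) : set R :=
  [set s | ~ {for s, continuous u}].

Definition piecewise_constant (u : R -> R) : Prop :=
  (forall a b : R, finite_set (discontinuities u `&` `[a, b])) /\
  (forall a b : R, (forall s, s \in `]a, b[ -> {for s, continuous u}) ->
     forall s t, s \in `]a, b[ -> t \in `]a, b[ -> u s = u t).

Definition controls (Omega : set R) : set (R -> R) :=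
  [set u | piecewise_constant u /\ forall s, Omega (u s)].

Variables (A : 'M[R]_2) (eta : 'cV[R]_2).

Definition is_solution (v : 'cV[R]_2) (u : R -> R) (gamma : R -> 'cV[R]_2)
    : Prop :=
  [/\ gamma 0 = v, continuous gamma &
      forall s, ~ discontinuities u s ->
        is_derive s (1 : R) gamma (A *m gamma s + u s *: eta)].

(* The default value of [xget] is irrelevant when [u] is piecewise constant:
   there is then exactly one solution. *)
Definition phi (s : R) (v : 'cV[R]_2) (u : R -> R) : 'cV[R]_2 :=
  xget (fun=> 0) [set gamma | is_solution v u gamma] s.

Definition periodic_orbit (Omega : set R) (O : set 'cV[R]_2) : Prop :=
  exists v u, [/\ controls Omega u,
    (exists2 T, 0 < T & forall s, phi (s + T) v u = phi s v u) &
    O = [set phi s v u | s in [set: R]]].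

End LinearControlSystem.

(* Main.v *)
(* Let tau = pi / mu. Since A - lambda squares to - mu^2, the exponential of
   s A is e^(lambda s) (cos (mu s) + sin (mu s) / mu (A - lambda)), so that a
   time tau of the flow with constant control c is the homothety of centre
   v(c) = - c A^-1 eta and ratio - e^(pi lambda / mu). With P^+ and P^- as given,
   this half turn maps P^+ to P^- under u^- and P^- to P^+ under u^+. The
   control alternating between u^- and u^+ every tau time units therefore has
   the closed concatenation of the two arcs as a 2 tau-periodic trajectory from
   P^+. Solutions are unique because e^(-s A) times the difference of two of
   them is continuous with zero derivative off a locally finite set. *)
Require Import Defs.
From HB Require Import structures.
From mathcomp Require Import all_boot all_order all_algebra.
From mathcomp Require Import complex ring lra.
From mathcomp Require Import all_classical all_reals all_analysis.

Set Implicit Arguments.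
Unset Strict Implicit.
Unset Printing Implicit Defensive.

Import Order.TTheory GRing.Theory Num.Theory.
Import numFieldNormedType.Exports.

Local Open Scope classical_set_scope.
Local Open Scope ring_scope.

(** * Derivatives of matrix-valued functions *)

Lemma is_derive_mxP (R : realFieldType) (V : normedModType R) m n (M : V -> 'M[R]_(m, n))
    t v (D : 'M[R]_(m, n)) :
  is_derive t v M D <-> forall i j, is_derive t v (fun s => M s i j) (D i j).
Proof.
split=> [[dM <-] i j|dM].
  apply: DeriveDef; first by move/derivable_mxP: dM; exact.
  by rewrite derive_mx// mxE.
have dM' : derivable M t v by apply/derivable_mxP => i j; case: (dM i j).
apply: DeriveDef => //; rewrite derive_mx//; apply/matrixP => i j.
by rewrite mxE; case: (dM i j).
Qed.

Lemma is_derive_mulmx (R : realFieldType) (V : normedModType R) m n p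
    (M : V -> 'M[R]_(m, n)) (N : V -> 'M[R]_(n, p)) t v M' N' :
  is_derive t v M M' -> is_derive t v N N' ->
  is_derive t v (fun s => M s *m N s) (M' *m N t + M t *m N').
Proof.
move=> /is_derive_mxP dM /is_derive_mxP dN; apply/is_derive_mxP => i j.
rewrite (_ : (fun s => _) = \sum_k ((fun s => M s i k) * (fun s => N s k j))); last first.
  by apply/funext => s; rewrite mxE fct_sumE.
have dMN k := is_deriveM (dM i k) (dN k j).
apply: (is_derive_eq (is_derive_sum dMN)).
rewrite !mxE -big_split; apply: eq_bigr => k _ /=.
by rewrite /GRing.scale/= addrC [N t k j * _]mulrC.
Qed.

Lemma is_derive1_continuous (R : numFieldType) (W : normedModType R) (f : R -> W) x df :
  is_derive x (1 : R) f df -> {for x, continuous f}.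
Proof.
by move=> [/derivable1_diffP/differentiable_continuous].
Qed.

(** Only finitely many points of [D] lie between [x] and [y]. Cutting the interval at one of them
    shortens the list of exceptions; once the list is empty, the mean value theorem applies. *)
Lemma finite_derive0_cst (R : realType) (f : R -> R) (D : set R) :
  (forall a b, finite_set (D `&` `[a, b])) -> continuous f ->
  (forall s, ~ D s -> is_derive s (1 : R) f 0) -> forall x y, f x = f y.
Proof.
move=> finD fc df x y.
wlog xy : x y / x <= y.
  by move=> H; case: (leP x y) => [/H|/ltW/H] //.
have [r Dr] := (finite_seqP _).1 (finD x y).
(* Keeping only an inclusion in [r], and only for points strictly inside, gives a hypothesis that
   subintervals inherit, as the induction on [r] requires. *)
have {Dr} : forall s, D s -> x < s < y -> s \in r.
  move=> s Ds /andP[xs sy]; have : (D `&` `[x, y]) s.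
    by split=> //=; rewrite in_itv/= !ltW.
  by rewrite Dr.
elim: r x y xy => [|c r IH] x y xy Dr.
  have [s||_ _] := @MVT_segment R f (fun=> 0) x y xy.
  - by rewrite in_itv/= => xsy; apply: df => Ds; have := Dr _ Ds xsy.
  - exact: continuous_subspaceT.
  - by rewrite mul0r => /eqP; rewrite subr_eq0 => /eqP.
have [/andP[xc cy]|xcy] := boolP (x < c < y).
  rewrite (IH x c) ?(IH c y) ?ltW// => s Ds /andP[s1 s2].
    have := Dr s Ds; rewrite in_cons (lt_trans xc)//= s2 (gt_eqF s1)/=.
    exact.
  have := Dr s Ds; rewrite in_cons (lt_trans s2)//= s1 (lt_eqF s2)/=.
  exact.
apply: IH => // s Ds sxy; have := Dr s Ds sxy.
by rewrite in_cons => /orP[/eqP E|//]; move: xcy; rewrite -E sxy.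
Qed.

(** * Determinant and characteristic polynomial in size two *)

Lemma ord2_ind (P : 'I_2 -> Prop) : P 0 -> P 1 -> forall i, P i.
Proof.
move=> P0 P1 [[|[|//]] i]; first by rewrite (_ : Ordinal i = 0)//; exact: val_inj.
by rewrite (_ : Ordinal i = 1)//; exact: val_inj.
Qed.

Lemma det2E (F : comNzRingType) (M : 'M[F]_2) : \det M = M 0 0 * M 1 1 - M 0 1 * M 1 0.
Proof.
rewrite (expand_det_row _ 0) !big_ord_recl big_ord0 /cofactor !det_mx11 !mxE /=.
rewrite -[bump 0 0]/1%N expr1 expr0 mul1r addr0 mulN1r mulrN.
by congr (_ * M _ _ - M _ _ * M _ _); exact: val_inj.
Qed.

Lemma horner_char_poly2 (F : comNzRingType) (M : 'M[F]_2) (z : F) :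
  (char_poly M).[z] = z ^+ 2 - \tr M * z + \det M.
Proof.
rewrite horner_coef size_char_poly !big_ord_recl big_ord0 /= addr0.
have -> : (char_poly M)`_2 = 1.
  by have := char_poly_monic M; rewrite monicE /lead_coef size_char_poly => /eqP.
by rewrite -[bump 0 0]/1%N (@char_poly_trace _ 2)// char_poly_det; ring.
Qed.

(** * The exponential of [s A] *)

Section Spiral.
Variables (R : realType) (A : 'M[R]_2) (lambda mu : R).

(* This is e^(s A) when A has eigenvalues lambda +- i mu. *)
Definition spiral (s : R) : 'M[R]_2 :=
  (expR (lambda * s) * cos (mu * s)) *: 1%:M +
  (expR (lambda * s) * sin (mu * s) / mu) *: (A - lambda%:M).

Lemma spiral0 : spiral 0 = 1%:M.
Proof. by rewrite /spiral !mulr0 expR0 cos0 sin0 mulr0 mul0r scale0r addr0 mulr1 scale1r. Qed.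

Lemma spiral_comm s : A *m spiral s = spiral s *m A.
Proof.
rewrite /spiral mulmxDr mulmxDl -!scalemxAr -!scalemxAl mulmx1 mul1mx mulmxBr mulmxBl.
by rewrite scalar_mxC.
Qed.

Hypothesis mu_neq0 : mu != 0.

Lemma spiral_pi : spiral (pi / mu) = (- expR (pi * lambda / mu))%:M.
Proof.
rewrite /spiral [mu * _]mulrC divfK// cospi sinpi mulr0 mul0r scale0r addr0 mulrN1.
by rewrite scalemx1 mulrA [lambda * pi]mulrC.
Qed.

Hypotheses (trA : \tr A = lambda *+ 2) (detA : \det A = lambda ^+ 2 + mu ^+ 2).

Let N := A - lambda%:M.

(** This is Cayley-Hamilton after completing the square, the characteristic polynomial being
    [(X - lambda)^2 + mu^2]. It is checked on entries: the trace eliminates [A 1 1], the determinant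
    [A 0 1 * A 1 0]. *)
Lemma sqr_sub_eigenvalue_re : N *m N = - (mu ^+ 2)%:M.
Proof.
have trA' : A 0 0 + A 1 1 = lambda *+ 2.
  by rewrite -trA /mxtrace !big_ord_recl big_ord0 addr0; congr (_ + A _ _); exact: val_inj.
have detA' := detA; rewrite det2E in detA'.
have A11 : A 1 1 = lambda *+ 2 - A 0 0 by rewrite -trA'; ring.
rewrite A11 in detA'.
have A01 : A 0 1 * A 1 0 = A 0 0 * (lambda *+ 2 - A 0 0) - (lambda ^+ 2 + mu ^+ 2).
  by rewrite -detA'; ring.
have l01 : lift ord0 ord0 = 1 :> 'I_2 by exact: val_inj.
apply/matrixP; apply: ord2_ind; apply: ord2_ind;
  rewrite !mxE !big_ord_recl big_ord0 /= l01 !mxE /= ?mulr1n ?mulr0n ?subr0 ?A11.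
- transitivity ((A 0 0 - lambda) ^+ 2 + A 0 1 * A 1 0); [ring|rewrite A01; ring].
- ring.
- ring.
- transitivity ((A 0 0 - lambda) ^+ 2 + A 0 1 * A 1 0); [ring|rewrite A01; ring].
Qed.

(** [N] acts as [mu] times the imaginary unit, so the span of [1] and [N] multiplies like the
    complex numbers. The group law and the derivative of [spiral] both reduce to this. *)
Lemma spiral_mul a b c d : (a *: 1%:M + b *: N) *m (c *: 1%:M + d *: N) =
  (a * c - b * d * mu ^+ 2) *: 1%:M + (a * d + b * c) *: N.
Proof.
rewrite mulmxDl !mulmxDr -!scalemxAl -!scalemxAr !mul1mx mulmx1 sqr_sub_eigenvalue_re.
by apply/matrixP => i j; rewrite !mxE; case: (i == j); rewrite ?mulr1n ?mulr0n; ring.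
Qed.

Lemma spiralD s t : spiral (s + t) = spiral s *m spiral t.
Proof.
rewrite /spiral -/N spiral_mul !mulrDr expRD cosD sinD.
by congr (_ *: _ + _ *: _); field.
Qed.

Lemma is_derive_spiral s : is_derive s (1 : R) spiral (A *m spiral s).
Proof.
(* With [A] itself written in terms of [1] and [N], [spiral_mul] computes [A *m spiral s] too. *)
rewrite [A in A *m _](_ : A = lambda *: 1%:M + 1 *: N); last first.
  by rewrite scalemx1 scale1r /N addrC subrK.
rewrite /spiral -/N spiral_mul.
apply/is_derive_mxP => i j; rewrite !mxE.
set a : R := (i == j)%:R; set b := A i j - _.
have de : is_derive s 1 (expR \o ( *%R lambda)) (expR (lambda * s) * lambda).
  by apply: is_derive1_comp; apply: trigger_derive; rewrite /GRing.scale/= mulr1.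
have dc : is_derive s 1 (cos \o ( *%R mu)) (- sin (mu * s) * mu).
  by apply: is_derive1_comp; apply: trigger_derive; rewrite /GRing.scale/= mulr1.
have ds : is_derive s 1 (sin \o ( *%R mu)) (cos (mu * s) * mu).
  by apply: is_derive1_comp; apply: trigger_derive; rewrite /GRing.scale/= mulr1.
rewrite (_ : (fun s => _) = a *: ((expR \o *%R lambda) * (cos \o ( *%R mu))) +
  (b / mu) *: ((expR \o *%R lambda) * (sin \o ( *%R mu)))); last first.
  apply/funext => x; rewrite !mxE -/a -/b.
  rewrite -[RHS]/(a * (expR (lambda * x) * cos (mu * x)) + b / mu * (expR (lambda * x) * sin (mu * x))).
  by field.
apply: (is_derive_eq (is_deriveD (is_deriveZ _ (is_deriveM de dc)) (is_deriveZ _ (is_deriveM de ds)))).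
by rewrite /GRing.scale/=; field.
Qed.

End Spiral.

(** * Uniqueness of trajectories, and the flow of a constant control *)

Section Flow.
Variables (R : realType) (A : 'M[R]_2) (eta : 'cV[R]_2) (lambda mu : R).
Hypotheses (mu_neq0 : mu != 0) (trA : \tr A = lambda *+ 2)
  (detA : \det A = lambda ^+ 2 + mu ^+ 2).

Let E := spiral A lambda mu.

Lemma is_solution_unique v u gamma1 gamma2 : piecewise_constant u ->
  is_solution A eta v u gamma1 -> is_solution A eta v u gamma2 -> gamma1 = gamma2.
Proof.
move=> [finu _] [g10 g1c g1d] [g20 g2c g2d].
pose d s := gamma1 s - gamma2 s.
have dd s : ~ discontinuities u s -> is_derive s (1 : R) d (A *m d s).
  move=> us; apply: (is_derive_eq (is_deriveB (g1d s us) (g2d s us))).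
  by rewrite mulmxBr opprD addrACA subrr addr0.
have dE s : is_derive s (1 : R) (fun s => E (- s)) (- (A *m E (- s))).
  apply/is_derive_mxP => i j.
  have /is_derive_mxP/(_ i j) dEij := is_derive_spiral mu_neq0 trA detA (- s).
  apply: (is_derive_eq (is_derive1_comp dEij (is_deriveNid s 1))).
  by rewrite mulrN1 [in RHS]mxE.
pose g s := E (- s) *m d s.
have gd s : ~ discontinuities u s -> is_derive s (1 : R) g 0.
  move=> us; apply: (is_derive_eq (is_derive_mulmx (dE s) (dd s us))).
  (* [E (- s)] commutes with [A], so the two terms of the product rule cancel. *)
  by rewrite mulNmx mulmxA -[E (- s) *m A]spiral_comm addNr.
have dc : continuous d by move=> s; apply: continuousB; [exact: g1c|exact: g2c].
have gc i j : continuous (fun s => g s i j).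
  rewrite (_ : (fun s => _) = \sum_k (fun s => E (- s) i k * d s k j)); last first.
    by apply/funext => s; rewrite /g mxE fct_sumE.
  move=> s; apply: (@big_ind _ (fun f : R -> R => {for s, continuous f})).
  - exact: cvg_cst.
  - by move=> f h fc hc; exact: continuousD.
  move=> k _; apply: continuousM.
    have /is_derive_mxP/(_ i k) := dE s; exact: is_derive1_continuous.
  apply: (@continuous_comp _ _ _ d (fun M => M k j)); first exact: dc.
  exact: coord_continuous.
have g0 s : g s = 0.
  apply/matrixP => i j; rewrite [RHS]mxE.
  rewrite (@finite_derive0_cst R (fun s => g s i j) (discontinuities u) finu (gc i j) _ s 0).
    by rewrite /g /d g10 g20 subrr mulmx0 mxE.
  by move=> t ut; have /is_derive_mxP/(_ i j) := gd t ut; rewrite mxE.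
apply/funext => s; apply/eqP; rewrite -subr_eq0 -/(d s).
(* Since [E s] inverts [E (- s)], [d s] is recovered as [E s *m g s]. *)
by rewrite -[d s]mul1mx -(spiral0 A lambda mu) -[0](subrr s) spiralD// -mulmxA -/(g s) g0 mulmx0.
Qed.

Lemma phiE v u gamma : piecewise_constant u -> is_solution A eta v u gamma ->
  forall s, phi A eta s v u = gamma s.
Proof.
move=> pu sol s; rewrite /phi (xget_unique _ sol)// => gamma' sol'.
exact: is_solution_unique pu sol' sol.
Qed.

(* The term [c *: (invmx A *m eta)] is [- v(c)]. *)
Definition flow v (c s : R) : 'cV[R]_2 :=
  E s *m (v + c *: (invmx A *m eta)) - c *: (invmx A *m eta).

Lemma flow0 v c : flow v c 0 = v.
Proof. by rewrite /flow /E spiral0 mul1mx addrK. Qed.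

(** At time [pi / mu] the matrix [E] is scalar, so the line spanned by [A^-1 eta] is mapped into
    itself and the joining of the two arcs becomes an identity between real coefficients. *)
Lemma flow_half_turn c k : flow (k *: (invmx A *m eta)) c (pi / mu) =
  (- expR (pi * lambda / mu) * (k + c) - c) *: (invmx A *m eta).
Proof.
by rewrite /flow /E spiral_pi// mul_scalar_mx -scalerDl scalerA scalerBl.
Qed.

Lemma is_derive_flow v c s : is_derive s (1 : R) (flow v c) (A *m flow v c s + c *: eta).
Proof.
have Au : A \in unitmx.
  rewrite unitmxE detA unitfE; apply: lt0r_neq0.
  by rewrite ltr_wpDl ?sqr_ge0// exprn_even_gt0.
have dw := is_derive_cst (v + c *: (invmx A *m eta)) s (1 : R).
have dE := is_derive_spiral mu_neq0 trA detA s.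
apply: (is_derive_eq (is_deriveB (is_derive_mulmx dE dw) (is_derive_cst (c *: (invmx A *m eta)) s (1 : R)))).
rewrite mulmx0 addr0 subr0 mulmxBr mulmxA -scalemxAr mulKVmx//.
by rewrite subrK.
Qed.

Lemma flow_continuous v c : continuous (flow v c).
Proof. by move=> s; exact: is_derive1_continuous (is_derive_flow v c s). Qed.

Lemma phi_cst v c s : phi A eta s v (cst c) = flow v c s.
Proof.
have cc : continuous (cst c : R -> R) by exact: cst_continuous.
apply: phiE.
  split=> [a b|//]; rewrite (_ : _ `&` _ = set0)//.
  by rewrite -subset0 => t [/= + _]; apply; exact: cc.
by split; [exact: flow0|exact: flow_continuous|move=> t _; exact: is_derive_flow].
Qed.

End Flow.

(** * Alternating concatenation of two functions *)

Section Switch.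
Variables (R : realType) (T : Type) (tau : R) (f : bool -> R -> T).

(** The codomain [T] is arbitrary so that one construction yields both the control (constant
    branches) and the trajectory (arcs of the two flows). Each branch is run in the local time of
    its cell. *)
Definition switch (s : R) : T :=
  let k := Num.floor (s / tau) in f (odd `|k|) (s - k%:~R * tau).

Hypothesis tau_gt0 : 0 < tau.

Lemma switchE (k : int) r : 0 <= r < tau -> switch (k%:~R * tau + r) = f (odd `|k|) r.
Proof.
move=> /andP[r0 rt]; rewrite /switch/=.
have -> : Num.floor ((k%:~R * tau + r) / tau) = k.
  apply: floor_def; rewrite mulrDl mulfK ?gt_eqF// lerDl divr_ge0 ?(ltW tau_gt0)//=.
  by rewrite intrD ltrD2l ltr_pdivrMr// mul1r.
by rewrite (addrC (_ * _)) addrK.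
Qed.

Lemma switch_cell s : exists (k : int) r, 0 <= r < tau /\ s = k%:~R * tau + r.
Proof.
have := floor_itv (s / tau); set k := Num.floor _ => /andP[k1 k2].
exists k, (s - k%:~R * tau); split; last by rewrite addrC subrK.
rewrite subr_ge0 -ler_pdivlMr// k1/= ltrBlDr.
by rewrite -[X in X + _]mul1r -mulrDl -ltr_pdivrMr// addrC -[1]/(1%:~R) -intrD.
Qed.

(** For negative [k] the absolute value goes down by one instead of up, which flips the parity all
    the same. *)
Lemma odd_abszS (k : int) : odd `|k + 1| = ~~ odd `|k|.
Proof.
case: k => n; first by rewrite addrC -intS !absz_nat.
have -> : Negz n + 1 = - n%:Z by rewrite NegzE intS opprD addrC addrA subrr add0r.
by rewrite abszN /= negbK.
Qed.

Lemma switch_periodic s : switch (s + tau *+ 2) = switch s.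
Proof.
have [k [r [rt ->]]] := switch_cell s.
have -> : k%:~R * tau + r + tau *+ 2 = (k + 1 + 1)%:~R * tau + r.
  by rewrite !intrD -[1%:~R]/1; ring.
by rewrite !switchE// !odd_abszS negbK.
Qed.

Lemma near_switch (k : int) r : 0 < r < tau ->
  \forall t \near k%:~R * tau + r, f (odd `|k|) (t - k%:~R * tau) = switch t.
Proof.
move=> /andP[r0 rt].
have : \forall t \near k%:~R * tau + r, t \in `]k%:~R * tau, k%:~R * tau + tau[.
  by apply: near_in_itvoo; rewrite in_itv/= ltrDl r0 ltrD2l.
apply: filterS => t; rewrite in_itv/= => /andP[t1 t2].
rewrite -[t in RHS](subrKC (k%:~R * tau)) switchE//.
by rewrite subr_ge0 ltW//= ltrBlDl.
Qed.

(** On the two sides of a node different branches apply. A disjunction is enough for continuity, as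
    both branches have the same limit at the node. *)
Lemma near_switch_node (k : int) : f (odd `|k - 1|) tau = f (odd `|k|) 0 ->
  \forall t \near k%:~R * tau, switch t = f (odd `|k - 1|) (t - (k - 1)%:~R * tau) \/
    switch t = f (odd `|k|) (t - k%:~R * tau).
Proof.
move=> fk.
have : \forall t \near k%:~R * tau, t \in `]k%:~R * tau - tau, k%:~R * tau + tau[.
  by apply: near_in_itvoo; rewrite in_itv/= ltrBlDr ltrDl tau_gt0.
apply: filterS => t; rewrite in_itv/= => /andP[t1 t2].
have [kt|tk] := leP (k%:~R * tau) t.
  right; rewrite -[t in LHS](subrKC (k%:~R * tau)) switchE//.
  by rewrite subr_ge0 kt ltrBlDl.
left; rewrite -[t in LHS](subrKC ((k-1)%:~R * tau)) switchE//.
rewrite intrB mulrBl -[1%:~R]/1 mul1r subr_ge0 ltW//=.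
by rewrite ltrBlDl subrK.
Qed.

End Switch.

Lemma switch_continuous (R : realType) (T : topologicalType) (tau : R)
    (f : bool -> R -> T) : 0 < tau -> (forall b, continuous (f b)) ->
  (forall b, f b tau = f (~~ b) 0) -> continuous (switch tau f).
Proof.
move=> tau0 fc fg s.
have fkc (k : int) t : {for t, continuous (fun t => f (odd `|k|) (t - k%:~R * tau))}.
  apply: (@continuous_comp _ _ _ (fun t => t - k%:~R * tau)); last exact: fc.
  exact: is_derive1_continuous (is_derive_shift t 1 (- (k%:~R * tau))).
have [k [r [/andP[]]]] := switch_cell tau0 s.
rewrite le_eqVlt => /orP[/eqP <- _|r0 rt] ->; last first.
  have rtau : 0 < r < tau by rewrite r0.
  have fkr := near_switch f tau0 k rtau.
  rewrite /continuous_at -(nbhs_singleton fkr).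
  exact: cvg_trans (near_eq_cvg fkr) (fkc _ _).
have fk : f (odd `|k - 1|) tau = f (odd `|k|) 0.
  by rewrite fg -odd_abszS subrK.
rewrite addr0 => U.
rewrite -[X in switch _ _ X](addr0 (k%:~R * tau)) switchE ?lexx// => Uk.
(* At the node the local time of the preceding cell is [tau], where its branch takes the initial
   value of the next one. *)
have Uk1 : \forall t \near k%:~R * tau, U (f (odd `|k - 1|) (t - (k - 1)%:~R * tau)).
  apply: (fkc (k - 1) (k%:~R * tau)) => /=.
  by rewrite -mulrBl -intrB subKr mul1r fk.
have Uk2 : \forall t \near k%:~R * tau, U (f (odd `|k|) (t - k%:~R * tau)).
  by apply: (fkc k (k%:~R * tau)) => /=; rewrite subrr.
have := near_switch_node tau0 fk.
apply: filterS3 Uk1 Uk2 => t U1 U2 [] /= E; first by rewrite E.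
by rewrite E.
Qed.

(** The trajectory may have a corner at each node, and the differential equation is only required
    where the control is continuous; hence every node must be a genuine discontinuity of the
    control. *)
Lemma switch_cst_discontinuous (R : realType) (tau : R) (c : bool -> R) (k : int) :
  0 < tau -> c false != c true ->
  ~ {for k%:~R * tau, continuous (switch tau (fun b => cst (c b)))}.
Proof.
move=> tau0 cft uc.
have uk : switch tau (fun b => cst (c b)) (k%:~R * tau) = c (odd `|k|).
  by rewrite -[X in switch _ _ X](addr0 (k%:~R * tau)) switchE ?lexx.
(* The full height of the jump serves as epsilon: a point of the preceding cell then contradicts the
   strict bound. *)
have e0 : 0 < `|c false - c true| by rewrite normr_gt0 subr_eq0.
move/cvgrPdist_lt : uc => /(_ _ e0); rewrite /= uk => ukt.
have [t [+ kt tk]] : exists t, [/\ `|c (odd `|k|) - switch tau (fun b => cst (c b)) t| <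
   `|c false - c true|, (k - 1)%:~R * tau <= t & t < k%:~R * tau].
  near (k%:~R * tau)^'- => t; exists t; split.
  - by near: t; exact: cvg_within ukt.
  - near: t; apply: nbhs_left_ge; rewrite ltr_pM2r// ltr_int.
    by rewrite ltrBlDr ltrDl.
  - by near: t; apply: nbhs_left_lt.
rewrite -[X in switch _ _ X](subrKC ((k - 1)%:~R * tau)) switchE//; last first.
  by rewrite subr_ge0 kt/= intrB mulrBl -[1%:~R]/1 mul1r ltrBlDl subrK.
rewrite -[k in c (odd `|k|)](subrK 1) odd_abszS /=.
by case: odd => /=; rewrite ?ltxx// distrC ltxx.
Unshelve. all: by end_near. Qed.

Lemma switch_cst_piecewise_constant (R : realType) (tau : R) (c : bool -> R) :
  0 < tau -> c false != c true -> piecewise_constant (switch tau (fun b => cst (c b))).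
Proof.
move=> tau0 cft; set u := switch _ _; split=> a b.
  (* Discontinuities occur only at nodes, and the nodes of [[a, b]] have indices between the floors
     of [a / tau] and [b / tau]. *)
  pose m := Num.floor (a / tau); pose n := `|Num.floor (b / tau) - m|%N.
  apply: (@sub_finite_set _ _ [set (m + i%:Z)%:~R * tau | i in `I_n.+1]); last first.
    exact/finite_image/finite_II.
  move=> s [/= us]; rewrite in_itv/= => /andP[as_ sb].
  have [k [r [/andP[]]]] := switch_cell tau0 s.
  rewrite le_eqVlt => /orP[/eqP <- _|r0 rt] sE; last first.
    exfalso; apply: us; rewrite sE.
    have rtau : 0 < r < tau by rewrite r0.
    have fkr := near_switch (fun b => cst (c b)) tau0 k rtau.
    rewrite /prop_for /continuous_at /u -(nbhs_singleton fkr).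
    by apply: cvg_trans (near_eq_cvg fkr) _; exact: cvg_cst.
  rewrite addr0 in sE.
  have mk : m <= k.
    by rewrite -ltzD1 floor_lt_int ltr_pdivrMr// (le_lt_trans as_)// sE ltr_pM2r// ltr_int ltrDl.
  have kb : k <= Num.floor (b / tau) by rewrite floor_ge_int ler_pdivlMr// -sE.
  exists `|k - m|%N; last by rewrite gez0_abs ?subr_ge0// subrKC.
  rewrite /= ltnS -lez_nat !gez0_abs ?subr_ge0 ?(le_trans mk)//.
  by rewrite lerD2r.
move=> uc s t.
wlog st : s t / s <= t.
  by move=> H sab tab; case: (leP s t) => [/H|/ltW/H] -> //.
rewrite !in_itv/= => /andP[as_ sb] /andP[at_ tb].
have uv x : u x = c false \/ u x = c true.
  by have [k [r [rt ->]]] := switch_cell tau0 x; rewrite /u switchE//; case: odd; [right|left].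
apply: contrapT => ust.
(* Two different values of [u] would be [c false] and [c true]; by continuity [u] would also reach
   their midpoint, which is neither. *)
have [||x _] := @IVT R u s t ((c false + c true) / 2) st.
- apply: continuous_in_subspaceT => x; rewrite inE/= in_itv/= => /andP[sx xt].
  by apply: uc; rewrite in_itv/= (lt_le_trans as_)// (le_lt_trans xt).
- move: ust; case: (uv s) (uv t) => -> [] -> ust; try by case: ust.
    move: cft; rewrite neq_lt => /orP[] /ltW H.
      by rewrite (min_l H) (max_r H); lra.
    by rewrite (min_r H) (max_l H); lra.
  move: cft; rewrite neq_lt => /orP[] /ltW H.
    by rewrite (min_r H) (max_l H); lra.
  by rewrite (min_l H) (max_r H); lra.
- by move=> uE; move: cft; case: (uv x); rewrite uE => E; move/eqP; apply; lra.
Qed.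

(** Cells are half-open, yet the closed intervals give the same range: the end of a branch is the
    start of the other one. *)
Lemma range_switch (R : realType) (T : Type) (tau : R) (f : bool -> R -> T) :
  0 < tau -> (forall b, f b tau = f (~~ b) 0) ->
  range (switch tau f) = f false @` `[0, tau] `|` f true @` `[0, tau].
Proof.
move=> tau0 fg; apply/seteqP; split=> [_ [s _ <-]|].
  have [k [r [rt ->]]] := switch_cell tau0 s; rewrite switchE//.
  have rI : r \in `[0, tau] by move: rt => /andP[r0 /ltW rt]; rewrite in_itv/= r0.
  by case: odd; [right|left]; exists r.
have sub b : f b @` `[0, tau] `<=` range (switch tau f).
  have fI b' r : 0 <= r < tau -> range (switch tau f) (f b' r).
    (* Cell [0] carries [f false] and cell [1] carries [f true]. *)
    move=> rt; exists ((b' : nat)%:Z%:~R * tau + r) => //.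
    by rewrite switchE//; case: b'.
  move=> _ [r + <-]; rewrite /= in_itv/= => /andP[r0].
  rewrite le_eqVlt => /orP[/eqP ->|rt]; last by apply: fI; rewrite r0.
  by rewrite fg; apply: fI; rewrite lexx.
by move=> x [] /sub.
Qed.

(** The imaginary part of the characteristic equation is [mu] times [2 lambda - \tr A], which gives
    the trace; the real part then gives the determinant. *)
Lemma tr_det_complex_eigenvalue (R : realType) (A : 'M[R]_2) (lambda mu : R) :
  mu != 0 -> eigenvalue (map_mx (real_complex R) A) (lambda +i* mu)%C ->
  \tr A = lambda *+ 2 /\ \det A = lambda ^+ 2 + mu ^+ 2.
Proof.
move=> mu0; rewrite eigenvalue_root_char /root horner_char_poly2 trace_map_mx det_map_mx.
rewrite expr2 eq_complex /= => /andP[/eqP re /eqP im].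
have trA : \tr A = lambda *+ 2.
  apply: (mulIf mu0); apply/eqP; rewrite -subr_eq0; apply/eqP.
  by rewrite -[RHS]oppr0 -[in RHS]im; ring.
split=> //; apply/eqP; rewrite -subr_eq0 -[X in _ == X]re trA; apply/eqP; ring.
Qed.

(** * The periodic orbit *)

Theorem proposition3p4 (R : realType) (A : 'M[R]_2) (eta : 'cV[R]_2)
    (lambda mu uminus uplus : R)
    (hdisc : (\tr A) ^+ 2 - 4 * \det A < 0)
    (htr : \tr A != 0)
    (hmu : 0 < mu)
    (heig : forall z : R[i], eigenvalue (map_mx (real_complex R) A) z <->
       z = (lambda +i* mu)%C \/ z = (lambda -i* mu)%C)
    (heta : eta != 0)
    (hu : uminus < uplus) :
  let q := expR (pi * lambda / mu) in
  let Pplus := ((- uplus + q * uminus) / (1 - q)) *: (invmx A *m eta) in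
  let Pminus := ((- uminus + q * uplus) / (1 - q)) *: (invmx A *m eta) in
  periodic_orbit A eta `[uminus, uplus]
    ([set phi A eta s Pplus (cst uminus) | s in `[0, pi / mu]] `|`
     [set phi A eta s Pminus (cst uplus) | s in `[0, pi / mu]]).
Proof.
move=> q Pplus Pminus.
have mu0 : mu != 0 by rewrite gt_eqF.
have [trA detA] := tr_det_complex_eigenvalue mu0 ((heig _).2 (or_introl erefl)).
(* If [q = 1] then [lambda = 0], and the trace would vanish. *)
have q1 : 1 - q != 0.
  apply: contra htr; rewrite subr_eq0 eq_sym => /eqP; rewrite -expR0 => /expR_inj/eqP.
  rewrite !mulf_eq0 invr_eq0 (negPf mu0) orbF gt_eqF ?pi_gt0//= trA => /eqP ->.
  by rewrite mul0rn.
set tau := pi / mu; have tau0 : 0 < tau by rewrite divr_gt0// pi_gt0.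
pose c b := if b then uplus else uminus.
pose P b := if b then Pminus else Pplus.
pose F b := flow A eta lambda mu (P b) (c b).
have F0 b : F b 0 = P b by exact: flow0.
(* The coefficients of [Pplus] and [Pminus] solve the two affine equations saying that the half
   turns exchange these points. *)
have Ftau b : F b tau = F (~~ b) 0.
  by rewrite F0 /F; case: b; rewrite /P /= flow_half_turn -/q//; congr (_ *: _);
    rewrite /c; field.
have c01 : c false != c true by rewrite lt_eqF.
pose u := switch tau (fun b => cst (c b)).
have pu : piecewise_constant u by exact: switch_cst_piecewise_constant.
have sol : is_solution A eta Pplus u (switch tau F).
  split.
  - by have := switchE F tau0 0 (r := 0); rewrite mul0r addr0 => ->; rewrite ?lexx ?F0.
  - by apply: switch_continuous => // b; exact: flow_continuous.
  move=> s us; have [k [r [/andP[]]]] := switch_cell tau0 s.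
  (* At a node ([r = 0]) the control jumps and no derivative is required; inside a cell the
     trajectory is locally a single branch of the flow. *)
  rewrite le_eqVlt => /orP[/eqP r0 _|r0 rt] sE.
    rewrite sE -r0 addr0 in us.
    by exfalso; apply: us; exact: switch_cst_discontinuous.
  have rt' : 0 < r < tau by rewrite r0.
  have -> : switch tau F s = F (odd `|k|) (s - k%:~R * tau).
    by rewrite sE -(nbhs_singleton (near_switch F tau0 k rt')).
  have -> : u s = c (odd `|k|) by rewrite /u sE switchE// ltW.
  rewrite sE; apply: (near_eq_is_derive (near_switch F tau0 k rt')).
  have dF := is_derive_flow eta mu0 trA detA (P (odd `|k|)) (c (odd `|k|))
    (k%:~R * tau + r - k%:~R * tau).
  (* The chain rule is applied entrywise; the shift to local time has derivative [1]. *)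
  apply/is_derive_mxP => i j; have /is_derive_mxP/(_ i j) dFij := dF.
  apply: (is_derive_eq (is_derive1_comp (g := shift (- (k%:~R * tau))) dFij
    (is_derive_shift (k%:~R * tau + r) 1 _))).
  by rewrite mulr1.
have phiF s : phi A eta s Pplus u = switch tau F s by exact: (phiE mu0 trA detA pu sol).
exists Pplus, u; split.
- split=> // s; have [k [r [rt ->]]] := switch_cell tau0 s; rewrite /u switchE//=.
  by rewrite in_itv/=; case: odd; rewrite lexx (ltW hu).
- exists (tau *+ 2); first by rewrite mulrn_wgt0.
  by move=> s; rewrite !phiF switch_periodic.
transitivity (range (switch tau F)); last first.
  by congr (image _ _); apply/funext => s; rewrite phiF.
rewrite range_switch//; congr (_ `|` _); congr (image _ _); apply/funext => s;
  by rewrite (phi_cst eta mu0 trA detA).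
Qed.
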